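(* Let $d\geq 1$, $r\geq 2$, and let $n=(r-1)(d+1)$. Let $A\subset \mathbb{R}^d$ be a finite set of points with $|A|>n$. Then there exist a partition $A=A_1\cup\cdots\cup A_r$ and a subset $B\subsetneq A$ with $|B|=n$ such that for every $p\in A\setminus B$, \[\bigcap_{i=1}^r \operatorname{conv}\big((B\cup\{p\})\cap A_i\big)\neq\emptyset.\]
   Context: $\operatorname{conv}$ denotes the convex hull. (In the paper's terminology, $B$ is a ''Tverberg center'' of size $n$ for the partition $A_1,\ldots,A_r$.) *)

(* Defs.v *)
From mathcomp Require Export all_boot all_order all_algebra finmap.
From mathcomp Require Export all_classical all_reals.
From mathcomp Require Export convex.

Set Implicit Arguments.
Unset Strict Implicit.
Unset Printing Implicit Defensive.

Local Open Scope classical_set_scope.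

Definition convex_hull (R : realType) (E : lmodType R) (X : set E) : set E :=
  smallest (@convex_set R E) X.

(* Main.v *)
(** Sarkaria's tensor trick turns the problem into one about vectors: to every
    a in A and every colour j < r it attaches c a j in R^n, with
    sum_j c a j = 0, in such a way that 0 being a convex combination of the
    c a (k a), a in X, forces the colour classes of X under k to have
    intersecting convex hulls. So it suffices to find a colouring k and an n-set
    B such that 0 is a convex combination of B + p (coloured by k) for every p
    outside B.

    If every n of these vectors with distinct a are independent, linear
    programming does this. Fix a generic h in the cone of some colourful basis,
    and among all colourful bases whose cone contains h take one maximising one
    fixed coordinate of h. For p outside the basis, since sum_j c p j = 0, some
    colour j makes the corresponding coordinate of -c p j positive; if some
    other coordinate of -c p j were negative, pivoting p into the basis would
    increase the maximised coordinate of h. Hence -c p j lies in the cone of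
    the basis.

    In general one perturbs along the moment curve and passes to the limit by
    compactness, there being finitely many choices of B and k. *)

Require Import Defs.
From mathcomp Require Import interval_inference topology normedtype derive ring.

Set Implicit Arguments.
Unset Strict Implicit.
Unset Printing Implicit Defensive.

Import Order.TTheory GRing.Theory Num.Theory.
Import numFieldNormedType.Exports.

Local Open Scope classical_set_scope.
Local Open Scope ring_scope.

(** * Polynomial non-roots and limits of convex relations *)

Lemma nonroot_gt (R : numDomainType) (p : {poly R}) (N : R) :
  p != 0 -> exists2 x, N < x & p.[x] != 0.
Proof.
move=> p0; set rs := [seq N + i%:R | i <- iota 1 (size p)].
have urs : uniq rs.
  rewrite map_inj_uniq ?iota_uniq// => i j /addrI /eqP.
  by rewrite eqr_nat => /eqP.
have /negP : ~ all (root p) rs.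
  by move=> /(max_poly_roots p0)/(_ urs); rewrite size_map size_iota ltnn.
case/allPn => x /mapP[i]; rewrite mem_iota => /andP[i_gt0 _] -> pi.
by exists (N + i%:R); rewrite ?ltrDl ?ltr0n.
Qed.

(** On the unit cube, [f] measures the failure to be a convex relation of the rows of [A], and
    attains its minimum. Were this positive at [l0], the relation given for some [x > M / f l0]
    would have a smaller defect, at most [M / x]. *)
Lemma lim_conv_relation (R : realType) (q n : nat) (A B : 'M[R]_(q, n)) :
  (forall N : R, exists2 x, N < x & exists l : 'rV[R]_q,
      [/\ forall i, 0 <= l 0 i, \sum_i l 0 i = 1
        & l *m (x *: A + B) = 0]) ->
  exists l : 'rV[R]_q,
    [/\ forall i, 0 <= l 0 i, \sum_i l 0 i = 1 & l *m A = 0].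
Proof.
move=> H.
pose K := [set l : 'rV[R]_q | forall i, `[0, 1]%classic (l ord0 i)].
have cK : compact K.
  apply: (@rV_compact R q (fun=> `[0, 1]%classic)) => i.
  exact: segment_compact.
pose f (l : 'rV[R]_q) := \sum_j `|\sum_i l 0 i * A i j| + `|\sum_i l 0 i - 1|.
have fc : continuous f.
  have sum_cont (F : 'I_q -> 'rV[R]_q -> R) :
      (forall i, continuous (F i)) -> continuous (fun l => \sum_i F i l).
    by move=> Fc; apply: continuous_big => //; exact: add_continuous.
  have c1 : continuous (fun l : 'rV[R]_q => \sum_i l 0 i - 1).
    have c0 : continuous (fun l : 'rV[R]_q => \sum_i l 0 i).
      by apply: sum_cont => i; exact: coord_continuous.
    by move=> l; exact: (cvgB (c0 l) (cvg_cst _)).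
  have c2 j : continuous (fun l : 'rV[R]_q => \sum_i l 0 i * A i j).
    apply: sum_cont => i l.
    exact: (cvgM (@coord_continuous _ _ _ _ _ _) (cvg_cst _)).
  have c3 : continuous (fun l : 'rV[R]_q => \sum_j `|\sum_i l 0 i * A i j|).
    apply: continuous_big => [|j _ l]; first exact: add_continuous.
    exact: (cvg_norm (c2 j l)).
  by move=> l; exact: (cvgD (c3 l) (cvg_norm (c1 l))).
have K0 : K !=set0 by exists 0 => i /=; rewrite mxE in_itv/= lexx ler01.
have [l0 l0K l0min] := EVT_min_rV K0 cK (continuous_subspaceT fc).
rewrite inE in l0K.
have f_ge0 l : 0 <= f l by rewrite addr_ge0// sumr_ge0.
have := f_ge0 l0; rewrite le_eqVlt => /orP[/eqP/esym/eqP f0|f0].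
  exists l0; move: f0; rewrite paddr_eq0 ?sumr_ge0// => /andP[].
  rewrite psumr_eq0// => /allP lA; rewrite normr_eq0 subr_eq0 => /eqP l1.
  split=> // [i|]; first by have /= := l0K i; rewrite in_itv/= => /andP[].
  apply/matrixP => i j; rewrite ord1 !mxE; apply/eqP.
  by have := lA j (mem_index_enum _); rewrite normr_eq0.
pose M := \sum_j \sum_i `|B i j|.
have M0 : 0 <= M by rewrite sumr_ge0// => j _; rewrite sumr_ge0.
have [x xM [l [l_ge0 l1 lAB]]] := H (M / f l0).
have x0 : 0 < x by rewrite (le_lt_trans _ xM)// divr_ge0// ltW.
have l_le1 i : l 0 i <= 1.
  by rewrite -l1 (bigD1 i)//= lerDl sumr_ge0.
have lK : l \in K by rewrite inE => i /=; rewrite in_itv/= l_ge0 l_le1.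
have := l0min l lK; rewrite leNgt => /negP[].
rewrite /f l1 subrr normr0 addr0 -(ltr_pM2l x0).
apply: (@le_lt_trans _ _ M); last by rewrite -ltr_pdivrMr.
rewrite mulr_sumr; apply: ler_sum => j _.
have lAj : x * (\sum_i l 0 i * A i j) = - \sum_i l 0 i * B i j.
  have /matrixP/(_ 0 j) := lAB; rewrite mulmxDr -scalemxAr !mxE => /eqP.
  by rewrite addr_eq0 => /eqP.
rewrite -[x in x * _]gtr0_norm// -normrM lAj normrN.
apply: le_trans (ler_norm_sum _ _ _) _; apply: ler_sum => i _.
by rewrite normrM (ger0_norm (l_ge0 i)) ler_piMl.
Qed.

(** * Pivoting in the generic case *)

Definition selmx (R : realFieldType) (I J : finType) (n : nat)
    (c : I -> J -> 'rV[R]_n)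
    (x : {ffun 'I_n -> I} * {ffun 'I_n -> J}) : 'M[R]_n :=
  \matrix_i c (x.1 i) (x.2 i).

Section Core.
Variables (R : realFieldType) (I J : finType) (n : nat).
Variables (c : I -> J -> 'rV[R]_n).
Implicit Types x : {ffun 'I_n -> I} * {ffun 'I_n -> J}.

Definition generic_family := forall x, injectiveb x.1 -> selmx c x \in unitmx.

(** Let the coordinates of [h] in the basis [x0] be the powers of some [t > 0]. Its coordinate [i]
    in a basis [x] is then the polynomial [q x i] at [t], nonzero as a polynomial because base
    changes are invertible; [t] has only finitely many roots to avoid. *)
Lemma generic_target (x0 : {ffun 'I_n -> I} * {ffun 'I_n -> J}) :
  generic_family -> injectiveb x0.1 ->
  exists h : 'rV[R]_n,
    [/\ forall i, 0 < (h *m invmx (selmx c x0)) 0 i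
      & forall x, injectiveb x.1 -> forall i, (h *m invmx (selmx c x)) 0 i != 0].
Proof.
move=> cG x0i.
pose q x i : {poly R} :=
  \poly_(l < n) (if insub l is Some k
                 then (selmx c x0 *m invmx (selmx c x)) k i else 0).
have q0 x i : injectiveb x.1 -> q x i != 0.
  move=> xi; apply: contraTneq isT => qe.
  have: col i (selmx c x0 *m invmx (selmx c x)) = 0.
    apply/matrixP => k j; rewrite mxE [RHS]mxE.
    have : (q x i)`_k = 0 by rewrite qe coef0.
    by rewrite coef_poly ltn_ord valK.
  move/(congr1 (mulmx (selmx c x *m invmx (selmx c x0)))).
  rewrite mulmx0 colE !mulmxA mulmxKV ?cG// mulmxV ?cG// mul1mx.
  by move/matrixP/(_ i 0)/eqP; rewrite !mxE !eqxx oner_eq0.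
have [|t t0] := @nonroot_gt R 
    (\prod_(x : {ffun 'I_n -> I} * {ffun 'I_n -> J} | injectiveb x.1)
       \prod_i q x i) 0.
  by apply/prodf_neq0 => x xi; apply/prodf_neq0 => i _; exact: q0.
rewrite horner_prod => /prodf_neq0 /= qt.
pose u : 'rV[R]_n := \row_k t ^+ k.
exists (u *m selmx c x0); split=> [i|x xi i].
  by rewrite mulmxK ?cG// mxE exprn_gt0.
have := qt x xi; rewrite horner_prod => /prodf_neq0 /(_ i isT).
rewrite horner_poly -mulmxA mxE; apply: contra_neq => e.
by rewrite -[RHS]e; apply: eq_bigr => k _; rewrite mxE valK mulrC.
Qed.

Lemma generic_colorful_center (o : 'I_n) (j0 : J) (s0 : 'I_n -> I) :
  generic_family -> (forall i, \sum_j c i j = 0) -> injective s0 ->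
  exists x, injectiveb x.1 /\ forall p, p \notin codom x.1 -> exists j,
    exists a : 'rV[R]_n, (forall i, 0 <= a 0 i) /\ c p j + a *m selmx c x = 0.
Proof.
move=> cG c0 s0i.
pose x0 : {ffun 'I_n -> I} * {ffun 'I_n -> J} := ([ffun i => s0 i], [ffun=> j0]).
have x0i : injectiveb x0.1.
  by apply/injectiveP => i k; rewrite !ffunE => /s0i.
have [h [h0 hn]] := generic_target cG x0i.
pose y x := h *m invmx (selmx c x).
pose P x := injectiveb x.1 && [forall i, 0 < y x 0 i].
have Px0 : P x0 by rewrite /P x0i; apply/forallP.
have [x /andP[xi /forallP y0] xmax] := arg_maxP (fun x => y x 0 o) Px0.
exists x; split=> // p px.
set M := selmx c x; have MU : M \in unitmx by exact: cG.
pose upd i j : {ffun 'I_n -> I} * {ffun 'I_n -> J} :=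
  ([ffun l => if l == i then p else x.1 l], [ffun l => if l == i then j else x.2 l]).
have updi i j : injectiveb (upd i j).1.
  apply/injectiveP => k l; rewrite !ffunE.
  case: eqP => [->|_]; case: eqP => [->//|_].
  - by move=> pe; rewrite pe codom_f in px.
  - by move=> pe; rewrite -pe codom_f in px.
  - by move/injectiveP : xi; apply.
have [al alM] : exists al : J -> 'rV[R]_n, forall j, al j *m M = - c p j.
  by exists (fun j => - c p j *m invmx M) => j; rewrite mulmxKV.
have DZE (u v : 'rV[R]_n) t l : (u + t *: v) 0 l = u 0 l + t * v 0 l.
  by rewrite !mxE.
have deltaE k l : (delta_mx 0 k : 'rV[R]_n) 0 l = (l == k)%:R.
  by rewrite mxE eqxx.
have updM i j (a : 'rV[R]_n) :
    a *m selmx c (upd i j) = a *m M + a 0 i *: (c p j - row i M).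
  rewrite !mulmx_sum_row (bigD1 i)//= [in RHS](bigD1 i)//=.
  rewrite rowK !ffunE eqxx scalerBr addrAC [_ + (_ - _)]addrC subrK.
  congr +%R; apply: eq_bigr => k ki.
  by rewrite !rowK !ffunE (negbTE ki).
(* Otherwise [al j + delta_mx 0 o] is a nonzero relation between the rows of the invertible
   [selmx c (upd o j)]. *)
have alo j : al j 0 o != 0.
  apply/eqP => al0; have /cG := updi o j; set M' := selmx _ _ => MU'.
  suff /(congr1 (mulmx^~ (invmx M'))) : (al j + delta_mx 0 o) *m M' = 0.
    rewrite mulmxK// mul0mx => /matrixP/(_ 0 o)/eqP.
    by rewrite mxE al0 deltaE eqxx add0r mxE (gt_eqF ltr01).
  rewrite updM mulmxDl alM -rowE mxE al0 deltaE add0r eqxx scale1r.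
  by rewrite addrA addrAC addrK addNr.
have [j jo] : exists j, 0 < al j 0 o.
  apply/existsP; apply: contraT; rewrite negb_exists => /forallP al0.
  have : \sum_j (- al j 0 o) = 0.
    rewrite sumrN -summxE; apply/eqP; rewrite oppr_eq0.
    suff -> : \sum_j al j = 0 by rewrite mxE.
    rewrite -[LHS](mulmxK MU) mulmx_suml.
    by under eq_bigr do rewrite alM; rewrite sumrN c0 oppr0 mul0mx.
  have aln k : 0 < - al k 0 o.
    by rewrite oppr_gt0 lt_neqAle alo/= leNgt al0.
  move/eqP; rewrite psumr_eq0 => [|k _]; last exact: ltW.
  by move=> /allP/(_ j0 (mem_index_enum _))/=; rewrite gt_eqF.
exists j, (al j); split; last by rewrite alM subrr.
move=> i; rewrite leNgt; apply/negP => ali.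
pose a := al j; pose rho k := y x 0 k / (- a 0 k).
(* Ratio test: the basis vector at position k leaves, and p enters. *)
have [k ak kmin] := @arg_minP _ _ _ i (fun k => a 0 k < 0) rho ali.
have tpos : 0 < rho k by rewrite divr_gt0// oppr_gt0.
(* Since [a *m M = - c p j], the second term subtracts [rho k *: c p j] from [h] and cancels
   coordinate [k]; the third restores it through [p], now at position [k]. *)
pose y' := y x + rho k *: a + rho k *: delta_mx 0 k.
have zk : (y x + rho k *: a) 0 k = 0.
  by rewrite DZE /rho invrN mulrN mulNr divfK ?lt_eqF// subrr.
have y'k : y' 0 k = rho k.
  by rewrite DZE zk add0r deltaE eqxx mulr1.
have y'M : y' *m selmx c (upd k j) = h.
  rewrite updM y'k !mulmxDl -!scalemxAl alM -rowE mulmxKV//.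
  by rewrite scalerN scalerBr -addrA [_ + (_ - _)]addrC subrK subrK.
have yupd : y (upd k j) = y' by rewrite /y -y'M mulmxK// cG.
(* Position [o] survives because [a 0 o > 0], and its coordinate grows by [rho k * a 0 o], against
   maximality. *)
have ok : o != k by apply: contraTneq ak => <-; rewrite -leNgt ltW.
suff Pupd : P (upd k j).
  have := xmax _ Pupd; rewrite yupd !DZE deltaE (negbTE ok) mulr0 addr0.
  by rewrite /= gerDl leNgt mulr_gt0.
(* By the choice of [h] no coordinate vanishes, so nonnegativity is enough. *)
rewrite /P updi; apply/forallP => l; rewrite lt_neqAle eq_sym hn// andTb yupd.
have [->|lk] := eqVneq l k; first by rewrite y'k ltW.
rewrite !DZE deltaE (negbTE lk) mulr0 addr0.
have [al0|al0] := leP 0 (a 0 l).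
  by apply: addr_ge0; [exact: ltW (y0 l)|apply: mulr_ge0 => //; exact: ltW].
have := kmin l al0; rewrite {2}/rho ler_pdivlMr ?oppr_gt0//.
by rewrite mulrN -subr_ge0 opprK.
Qed.
End Core.

(** * Perturbation to the generic case and passage to the limit *)

Section Perturbation.
Variables (R : realType) (I J : finType) (n : nat) (j0 : J).
Variable c : I -> J -> 'rV[R]_n.
Hypotheses (J_gt1 : (1 < #|J|)%N) (c0 : forall i, \sum_j c i j = 0).
Implicit Types x : {ffun 'I_n -> I} * {ffun 'I_n -> J}.

(* [g i j] has the form w_j v_i with sum_j w_j = 0 and the v_i on the moment
   curve, so any n of them with distinct i are independent. As only cones
   matter, c + g / t is replaced by [ct t] = t c + g, with t large. *)
Let w (j : J) : R := if j == j0 then - (#|J|.-1)%:R else 1.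
Let g (i : I) (j : J) : 'rV[R]_n := w j *: \row_l (enum_rank i)%:R ^+ l.
Let ct (t : R) (i : I) (j : J) := t *: c i j + g i j.

Let w_neq0 j : w j != 0.
Proof.
rewrite /w; case: (j =P j0) => _; last exact: oner_neq0.
by rewrite oppr_eq0 pnatr_eq0 -lt0n -subn1 subn_gt0.
Qed.

Let ct0 t i : \sum_j ct t i j = 0.
Proof.
rewrite big_split/= -scaler_sumr c0 scaler0 add0r -scaler_suml.
rewrite (bigD1 j0)//= {1}/w eqxx.
rewrite (eq_bigr (fun=> 1)) => [|j /negbTE jj0]; last by rewrite /w jj0.
by rewrite sumr_const cardC1 addNr scale0r.
Qed.

Let selmx_ct t x : selmx (ct t) x = t *: selmx c x + selmx g x.
Proof. by apply/row_matrixP => i; rewrite linearD linearZ/= !rowK. Qed.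

Let det_selmx_g x : injectiveb x.1 -> \det (selmx g x) != 0.
Proof.
move=> /injectiveP xi.
pose r : 'rV[R]_n := \row_i (enum_rank (x.1 i))%:R.
have -> : selmx g x = diag_mx (\row_i w (x.2 i)) *m (Vandermonde n r)^T.
  by apply/matrixP => i l; rewrite mul_diag_mx !mxE.
rewrite det_mulmx det_diag det_tr det_Vandermonde mulf_neq0//.
  by apply/prodf_neq0 => i _; rewrite mxE.
apply/prodf_neq0 => i _; apply/prodf_neq0 => k ik.
rewrite !mxE subr_eq0 eqr_nat; apply: contraTneq ik.
by move=> /val_inj/enum_rank_inj/xi ->; rewrite ltnn.
Qed.

(** Each determinant is a polynomial in [t], nonzero because its value at 0 is the determinant for
    [g]. *)
Lemma generic_perturbation N : exists2 t, N < t & generic_family (ct t).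
Proof.
pose q x : {poly R} := \det (map_mx polyC (selmx g x) +
                             'X *: map_mx polyC (selmx c x)).
have qE x t : (q x).[t] = \det (selmx (ct t) x).
  rewrite -[LHS]/(horner_eval t (q x)) -det_map_mx selmx_ct; congr (\det _).
  apply/matrixP => i l; rewrite !mxE /= /horner_eval.
  by rewrite !hornerE addrC.
have q0 x : injectiveb x.1 -> q x != 0.
  move=> xi; apply: contraNneq (det_selmx_g xi) => qx0.
  by have := qE x 0; rewrite qx0 horner0 selmx_ct scale0r add0r => <-.
have [|t Nt] := @nonroot_gt R
    (\prod_(x : {ffun 'I_n -> I} * {ffun 'I_n -> J} | injectiveb x.1) q x) N.
  exact/prodf_neq0.
rewrite horner_prod => /prodf_neq0 qt; exists t => // x xi.
by rewrite unitmxE unitfE -qE qt.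
Qed.

(** The last component colours the points outside the basis. All choices sit in one finite type, for
    a pigeonhole over [t]. *)
Let T : finType :=
  ({ffun 'I_n -> I} * {ffun 'I_n -> J} * {ffun I -> J})%type.

Let balanced (f : I -> J -> 'rV[R]_n) (D : T) p :=
  exists l : 'rV[R]_(1 + n), [/\ forall i, 0 <= l 0 i, \sum_i l 0 i = 1
    & l *m col_mx (f p (D.2 p)) (selmx f D.1) = 0].

Lemma perturbed_center N (o : 'I_n) (s0 : 'I_n -> I) : injective s0 ->
  exists2 t, N < t & exists D : T, injectiveb D.1.1 /\
    forall p, p \notin codom D.1.1 -> balanced (ct t) D p.
Proof.
move=> s0i; have [t Nt ctG] := generic_perturbation N; exists t => //.
have [x [xi xP]] := generic_colorful_center o j0 ctG (ct0 t) s0i.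
have /choice[k kP] : forall p, exists j, p \notin codom x.1 ->
    exists a : 'rV[R]_n,
      (forall i, 0 <= a 0 i) /\ ct t p j + a *m selmx (ct t) x = 0.
  move=> p; have [px|/xP[j ?]] := boolP (p \in codom x.1); first by exists j0.
  by exists j.
exists (x, [ffun p => k p]); split=> // p /kP[a [a0 aP]].
pose S := 1 + \sum_i a 0 i.
have S0 : 0 < S by rewrite ltr_pwDl// sumr_ge0.
exists (S^-1 *: row_mx 1%:M a); split=> [i||].
- rewrite mxE; apply: mulr_ge0; first by rewrite invr_ge0 ltW.
  rewrite -[i]fintype.splitK; case: (fintype.split i) => q /=.
    by rewrite row_mxEl mxE ler0n.
  by rewrite row_mxEr.
- transitivity (S^-1 * S); last by rewrite mulVf ?gt_eqF.
  under eq_bigr do rewrite mxE.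
  rewrite -mulr_sumr; congr *%R; rewrite big_split_ord/= big_ord1.
  rewrite row_mxEl mxE eqxx; congr +%R.
  by apply: eq_bigr => i _; rewrite row_mxEr.
- by rewrite -scalemxAl mul_row_col mul1mx ffunE aP scaler0.
Qed.

Lemma colorful_center_ffun (o : 'I_n) (s0 : 'I_n -> I) : injective s0 ->
  exists D : T, injectiveb D.1.1 /\
    forall p, p \notin codom D.1.1 -> balanced c D p.
Proof.
move=> s0i.
pose good t (D : T) := injectiveb D.1.1 /\
  forall p, p \notin codom D.1.1 -> balanced (ct t) D p.
have [D DP] : exists D, forall N, exists2 t, N < t & good t D.
  apply: contrapT => /forallNP nD.
  have /choice[N NP] : forall D, exists N, forall t, N < t -> ~ good t D.
    move=> D; have /existsNP[N NP] := nD D; exists N => t Nt gtD.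
    by apply: NP; exists t.
  (* A [t] beyond every threshold [N D] still has some good [D]. *)
  have [t Nt [D gtD]] := perturbed_center (\sum_D `|N D|) o s0i.
  apply: (NP D t) gtD; apply: le_lt_trans Nt.
  by rewrite (bigD1 D)//= (le_trans (ler_norm _))// lerDl sumr_ge0.
exists D; split=> [|p pD]; first by have [t _ []] := DP 0.
apply: (@lim_conv_relation _ _ _ _ (col_mx (g p (D.2 p)) (selmx g D.1))) => N.
have [t Nt [_ /(_ p pD)[l [l0 l1 lP]]]] := DP N; exists t => //; exists l.
by split; rewrite // scale_col_mx add_col_mx -selmx_ct.
Qed.

Lemma colorful_center : (0 < n <= #|I|)%N ->
  exists (B : {set I}) (k : I -> J), #|B| = n /\
    forall p, p \notin B -> exists l : I -> R,
      [/\ forall i, 0 <= l i, forall i, i \notin p |: B -> l i = 0,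
          \sum_i l i = 1 & \sum_i l i *: c i (k i) = 0].
Proof.
move=> /andP[n_gt0 nI].
pose s0 (i : 'I_n) : I := enum_val (widen_ord nI i).
have s0i : injective s0 by move=> i k /enum_val_inj/(congr1 val)/= /val_inj.
have [[x k] /= [xi xP]] := colorful_center_ffun (Ordinal n_gt0) s0i.
(* [k] is arbitrary on the basis points, where [x.2] holds the right colour. *)
pose kk a := if [pick i | x.1 i == a] is Some i then x.2 i else k a.
exists [set x.1 i | i in 'I_n]%SET, kk; split.
  by rewrite card_imset ?card_ord//; exact/injectiveP.
move=> p pB; have px : p \notin codom x.1.
  apply: contra pB => /codomP[i ->]; exact: imset_f.
have [l [l0 l1 lP]] := xP p px.
pose pt (q : 'I_(1 + n)) := if fintype.split q is inr i then x.1 i else p.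
have ptP q : row q (col_mx (c p (k p)) (selmx c x)) = c (pt q) (kk (pt q)).
  rewrite /pt -[q in LHS]fintype.splitK; case: fintype.split => i /=.
    rewrite rowKu ord1; have -> : row 0 (c p (k p)) = c p (k p).
      by apply/rowP => l'; rewrite mxE.
    rewrite /kk; case: pickP => // i' /eqP pe.
    by rewrite -pe codom_f in px.
  rewrite rowKd rowK /kk; case: pickP => [i' /eqP|/(_ i)/eqP//].
  by have /injectiveP xinj := xi; move=> /xinj ->.
exists (fun i => \sum_(q | pt q == i) l 0 q); split=> [i|i ipB||].
- by rewrite sumr_ge0.
- rewrite big1// => q /eqP qi; case/negP: ipB; rewrite -qi /pt !inE.
  by case: fintype.split => [?|i']; rewrite ?eqxx ?imset_f ?orbT.
- by rewrite -l1 [RHS](partition_big pt xpredT).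
- rewrite -[RHS]lP mulmx_sum_row [RHS](partition_big pt xpredT)//=.
  apply: eq_bigr => i _; rewrite scaler_suml; apply: eq_bigr => q /eqP <-.
  by rewrite ptP.
Qed.
End Perturbation.

(** * Sarkaria's tensor trick and the return to convex hulls *)

Lemma convex_set_sum (R : realType) (E : lmodType R) (C : set E)
    (T : eqType) (s : seq T) (w : T -> R) (F : T -> E) :
  convex_set C -> (forall i, 0 <= w i) -> (forall i, w i != 0 -> C (F i)) ->
  0 < \sum_(i <- s) w i ->
  C ((\sum_(i <- s) w i)^-1 *: \sum_(i <- s) w i *: F i).
Proof.
move=> cC w0 CF; elim: s => [|i s IH]; first by rewrite big_nil ltxx.
rewrite !big_cons; set W := \sum_(j <- s) w j; set G := \sum_(j <- s) _.
have W0 : 0 <= W by rewrite sumr_ge0.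
(* Zero weights are skipped, since [F i] may then lie outside [C]. *)
have [wi0|wi0] := eqVneq (w i) 0; first by rewrite wi0 scale0r !add0r => /IH.
move=> t0; have wi_gt0 : 0 < w i by rewrite lt_def wi0 w0.
have [We|Wn] := eqVneq W 0.
  rewrite We addr0 [G]big1_seq ?addr0 => [|j /andP[_ js]].
    by rewrite scalerA mulVf// scale1r; exact: CF.
  move/eqP: We; rewrite psumr_eq0// => /allP/(_ j js)/= /eqP ->.
  by rewrite scale0r.
have W_gt0 : 0 < W by rewrite lt_def Wn W0.
have a0 : 0 <= w i / (w i + W) by rewrite divr_ge0 ?(ltW t0).
have a1 : w i / (w i + W) <= 1 by rewrite ler_pdivrMr// mul1r lerDl.
have -> : (w i + W)^-1 *: (w i *: F i + G) =
    (w i / (w i + W)) *: F i + (1 - w i / (w i + W)) *: (W^-1 *: G).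
  rewrite scalerDr !scalerA mulrC; congr (_ + _ *: _).
  by field; rewrite Wn gt_eqF.
have := cC (F i) (W^-1 *: G) (Itv01 a0 a1).
by rewrite !inE; apply; [exact: CF|exact: IH].
Qed.

(* [sarkaria_vertex j] runs over e_0, ..., e_(m-1) and -(e_0 + ... + e_(m-1)),
   whose only linear relation is that they sum to 0; [sarkaria a j] is its tensor
   product with (a, 1). *)
Definition sarkaria_vertex (R : realType) (m r : nat) (j : 'I_r) (k : 'I_m) : R :=
  (j == k :> nat)%:R - (j == m :> nat)%:R.

Definition sarkaria (R : realType) (m r d : nat) (a : 'rV[R]_d) (j : 'I_r) :
    'rV[R]_(m * (d + 1)) :=
  mxvec (\matrix_(k < m, l < d + 1)
    (sarkaria_vertex R j k * (row_mx a (1%:M : 'M_1)) 0 l)).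

Lemma sum_sarkaria (R : realType) (m d : nat) (a : 'rV[R]_d) :
  \sum_(j < m.+1) sarkaria m a j = 0.
Proof.
rewrite -linear_sum; apply/eqP; rewrite mxvec_eq0; apply/eqP/matrixP => k l.
rewrite summxE [RHS]mxE; under eq_bigr do rewrite mxE.
rewrite -mulr_suml big_ord_recr/= (bigD1 k)//= /sarkaria_vertex/= !eqxx.
rewrite (ltn_eqF (ltn_ord k)) (gtn_eqF (ltn_ord k)) big1 => [|i ik].
  by rewrite subr0 addr0 sub0r subrr mul0r.
by rewrite (ltn_eqF (ltn_ord i)) -(inj_eq val_inj) in ik *; rewrite (negbTE ik) subr0.
Qed.

(** For [j < m], coordinate [j] of the vertex is 1 for colour [j], -1 for colour [m] and 0
    otherwise, so row [j] of the tensor relation is the difference of the two sums. *)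
Lemma sarkaria_balanced (R : realType) (m d : nat) (I : finType)
    (P : I -> 'rV[R]_d) (l : I -> R) (k : I -> 'I_m.+1) :
  \sum_i l i *: sarkaria m (P i) (k i) = 0 ->
  forall j, \sum_(i | k i == j) l i *: row_mx (P i) (1%:M : 'M_1) =
            \sum_(i | k i == ord_max) l i *: row_mx (P i) (1%:M : 'M_1).
Proof.
move=> e j.
have [->//|jm] := eqVneq j ord_max.
have jlt : (j < m)%N.
  by rewrite ltn_neqAle -ltnS ltn_ord andbT; apply: contra jm => /eqP jm; apply/eqP/val_inj.
pose q := Ordinal jlt.
apply/eqP; rewrite -subr_eq0; apply/eqP/matrixP => i0 l0; rewrite ord1.
have /(congr1 vec_mx)/matrixP/(_ q l0) := e.
rewrite linear0 linear_sum summxE [in X in X -> _]mxE => e'.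
rewrite mxE [RHS]mxE -[RHS]e' mxE !summxE.
rewrite [X in X - _ = _]big_mkcond [X in _ - X = _]big_mkcond -sumrB.
apply: eq_bigr => i _.
rewrite linearZ/= mxvecK !mxE /sarkaria_vertex/=.
have -> : (k i == ord_max) = (k i == m :> nat) by [].
have -> : (k i == j) = (k i == j :> nat) by [].
by case: (_ == _ :> nat); case: (_ == _ :> nat); rewrite /=; ring.
Qed.

Theorem theorem1p9 (R : realType) (d r n : nat)
    (hd : (1 <= d)%N) (hr : (2 <= r)%N) (hn : n = ((r - 1) * (d + 1))%N)
    (A : {fset 'rV[R]_d}) (hA : (n < #|` A|)%N) :
  exists (P : 'I_r -> set 'rV[R]_d) (B : {fset 'rV[R]_d}),
    [/\ partition [set: 'I_r] P [set` A],
        (B `<` A)%fset,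
        #|` B| = n
      & forall p : 'rV[R]_d, p \in (A `\` B)%fset ->
          \bigcap_(i in [set: 'I_r])
            convex_hull (([set` B] `|` [set p]) `&` P i) !=set0].
Proof.
(* With [r = m.+1], [n] is the dimension [m * (d + 1)] of the tensor space. *)
case: r hr hn => [//|m] hr; rewrite subn1/= => hn; rewrite {}hn in hA *.
have n_gt0 : (0 < m * (d + 1) <= #|{: A}|)%N.
  by rewrite -cardfE (ltnW hA) andbT muln_gt0 addn1 andbT.
have J_gt1 : (1 < #|'I_m.+1|)%N by rewrite card_ord.
have [B [k [cB BP]]] := colorful_center (c := fun a : A => sarkaria m (val a))
  ord0 J_gt1 (fun a => sum_sarkaria m (val a)) n_gt0.
pose P j : set 'rV[R]_d := [set val a | a in [set a : A | k a = j]].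
pose BF : {fset 'rV[R]_d} := [fset val a | a in B]%fset.
have inBF (a : A) : (val a \in BF) = (a \in B).
  by rewrite /BF mem_imfset//=; exact: val_inj.
have cBF : #|` BF| = (m * (d + 1))%N.
  by rewrite /BF card_imfset/=; [rewrite -cB cardE|exact: val_inj].
have sBF : (BF `<=` A)%fset.
  by apply/fsubsetP => _ /imfsetP[a _ ->]; exact: valP.
have pBF : (BF `<` A)%fset by rewrite fproperEcard sBF cBF.
have hull p : p \in (A `\` BF)%fset -> \bigcap_(i in [set: 'I_m.+1])
    convex_hull (([set` BF] `|` [set p]) `&` P i) !=set0.
  rewrite in_fsetD => /andP[pB pA].
  have [l [l0 lB l1 lP]] : exists l : A -> R, [/\ forall i, 0 <= l i,
      forall i, i \notin [` pA]%fset |: B -> l i = 0, \sum_i l i = 1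
      & \sum_i l i *: sarkaria m (val i) (k i) = 0].
    by apply: BP; rewrite -inBF.
  (* The first [d] coordinates of [S] are the weighted sum of a colour class, the last its weight
     [t], both the same for all colours. Their quotient is the common point. *)
  pose S := \sum_(i | k i == ord_max) l i *: row_mx (val i) (1%:M : 'M_1).
  have SE j : \sum_(i | k i == j) l i *: row_mx (val i) (1%:M : 'M_1) = S.
    exact: sarkaria_balanced lP j.
  have Sl j : \sum_(i | k i == j) l i *: val i = lsubmx S.
    rewrite -(SE j) linear_sum; apply: eq_bigr => i _.
    by rewrite linearZ/= row_mxKl.
  have Sr j : \sum_(i | k i == j) l i = rsubmx S 0 0.
    rewrite -(SE j) linear_sum summxE; apply: eq_bigr => i _.
    by rewrite linearZ/= row_mxKr !mxE eqxx mulr1.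
  set t := rsubmx S 0 0 in Sr.
  have t_gt0 : 0 < t.
    rewrite lt_def -{2}(Sr ord0) sumr_ge0 ?andbT//.
    apply: contraTneq (oner_neq0 R) => t0.
    rewrite negbK -l1 (partition_big k xpredT)//= big1// => j _.
    by rewrite Sr.
  exists (t^-1 *: lsubmx S) => j _ C [cC CX].
  pose w i := if k i == j then l i else 0.
  have wE : \sum_i w i = t by rewrite -big_mkcond Sr.
  have -> : lsubmx S = \sum_i w i *: val i.
    rewrite -(Sl j) big_mkcond; apply: eq_bigr => i _.
    by rewrite /w; case: ifP => // _; rewrite scale0r.
  rewrite -wE; apply: convex_set_sum => //.
  - by move=> i; rewrite /w; case: ifP.
  - move=> i; rewrite /w; case: ifP => [/eqP kij li0|_]; last by rewrite eqxx.
    apply: CX; split; last by exists i.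
    have : i \in [` pA]%fset |: B by apply: contraNT li0 => /lB ->.
    rewrite !inE => /orP[/eqP ->|iB]; first by right.
    by left; rewrite /= inBF.
  - by rewrite wE.
exists P, BF; split=> //; split.
- apply/seteqP; split => [_ [j _ [a _ <-]]|x xA]; first exact: valP.
  by exists (k [` xA]%fset) => //; exists [` xA]%fset.
- by move=> i j _ _ [_ [[a /= <- <-] [b /= <- /val_inj ->]]].
(* Parts must be nonempty: an empty colour class would have an empty hull, contradicting [hull] at
   any point of [A] outside [BF]. *)
- move=> j _; have /andP[_ /fsubsetPn[p pA pB]] := pBF.
  have [|z /(_ j I) zj] := hull p; first by rewrite in_fsetD pB pA.
  apply/set0P/eqP => Pj0; apply: (zj set0); split; last by rewrite Pj0 setI0.
  by move=> x y t; rewrite inE.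
Qed.
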